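(* Let $q\in\mathbb{C}$ with $|q|<1$, let $h\in\mathbb{N}$, let $m\in\mathbb{N}^{\ast}$, and let $a,b$ be odd positive integers. Then the following identity for the $(h,q)$-Genocchi polynomials in the argument $x$ holds true: $$[2]_{q^b}[a]_q^{m-1}\sum_{i=0}^{a-1}(-1)^iq^{ibh}G_{m,q^a}^{(h)}\left(bx+\frac{bi}{a}\right)=[2]_{q^a}[b]_q^{m-1}\sum_{i=0}^{b-1}(-1)^iq^{iah}G_{m,q^b}^{(h)}\left(ax+\frac{ai}{b}\right).$$
   Context: Here $\mathbb{N}$ is the set of natural numbers, $\mathbb{N}^{\ast}=\mathbb{N}\cup\{0\}$, and $[y]_q=\frac{1-q^y}{1-q}$, so $[2]_q=1+q$. For complex $q$ with $|q|<1$ the $(h,q)$-Genocchi polynomials $G_{n,q}^{(h)}(x)$ are given by the generating function $$\sum_{n=0}^{\infty}G_{n,q}^{(h)}(x)\frac{t^n}{n!}=[2]_q\,t\sum_{n=0}^{\infty}(-1)^nq^{hn}e^{[x+n]_qt},$$ i.e. $G_{0,q}^{(h)}(x)=0$ and $\frac{G_{n+1,q}^{(h)}(x)}{n+1}=[2]_q\sum_{l=0}^{\infty}(-1)^lq^{hl}[x+l]_q^n$ for $n\in\mathbb{N}^{\ast}$. $G_{m,q^a}^{(h)}$ and $[\,\cdot\,]_{q^a}$ are obtained by replacing $q$ by $q^a$, with $(q^a)^y=q^{ay}$; similarly for $b$. *)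

(* Defs.v *)
From HB Require Import structures.
From mathcomp Require Import all_boot all_order all_algebra.
From mathcomp Require Import all_classical all_reals all_analysis.
From mathcomp Require Export complex.
Import numFieldNormedType.Exports.
Import Order.TTheory GRing.Theory Num.Theory.

Set Implicit Arguments.
Unset Strict Implicit.
Unset Printing Implicit Defensive.

Local Open Scope ring_scope.
Local Open Scope classical_set_scope.
Local Open Scope complex_scope.

(* The topology of the norm, inherited from the numFieldType structure. *)
HB.instance Definition _ (R : realType) :=
  PseudoMetricNormedZmod.copy R[i] (R[i] : numFieldType)^o.

Definition cexp (R : realType) (z : R[i]) : R[i] :=
  (expR (complex.Re z))%:C * (cos (complex.Im z) +i* sin (complex.Im z)).

(* The power q^y needs a logarithm of q. A base is therefore a pair (q, L),
   where L is meant to satisfy cexp L = q when q is nonzero, and q^y is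
   cexp (y * L). Replacing q by q^a then means replacing (q, L) by
   (q ^+ a, a%:R * L), which makes (q^a)^y = q^(a y) hold for all complex y
   (with the principal logarithm of q ^+ a instead, it could fail).
   For q = 0 the convention is 0^0 = 1 and 0^y = 0 for y != 0. *)
Definition qpow (R : realType) (q L y : R[i]) : R[i] :=
  if q == 0 then (y == 0)%:R else cexp (y * L).

Definition qbracket (R : realType) (q L y : R[i]) : R[i] :=
  (1 - qpow q L y) / (1 - q).

(* Coefficient of t^m / m! in
   [2]_q t \sum_l (-1)^l q^(h l) exp ([x + l]_q t). *)
Definition genocchi (R : realType) (q L : R[i]) (h m : nat) (x : R[i]) :
    R[i] :=
  if m is n.+1 then
    n.+1%:R * (qbracket q L 2%:R *
      limn (series (fun l : nat =>
        (-1) ^+ l * q ^+ (h * l) * qbracket q L (x + l%:R) ^+ n)))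
  else 0.

(* Main.v *)
Require Import Defs.
From mathcomp Require Import all_boot all_order all_algebra.
From mathcomp Require Import all_classical all_reals all_analysis.
From mathcomp Require Import ring.
Import numFieldNormedType.Exports.
Import Order.TTheory GRing.Theory Num.Theory.
Local Open Scope ring_scope.
Local Open Scope complex_scope.

(** Put n = m - 1. The scaling rule [a]_q [y]_{q^a} = [a y]_q absorbs the
    factor [a]_q^n into the Genocchi polynomials to the base q^a
    (qbracket_genocchi_scale). Up to the factor m [2]_{q^a} [2]_{q^b}, which is
    symmetric in a and b, the left side becomes
<<
      sum_{i < a} (-1)^i sum_{l >= 0} (-1)^l T (b i + a l),
      T p = q^(h p) [a b x + p]_q^n.
>>
    Writing l = b k + j with j < b, where (-1)^l = (-1)^(k + j) because b is
    odd, turns this into the sum over i < a, j < b and k >= 0 of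
    (-1)^(i + j + k) T (b i + a j + a b k), which is symmetric under exchanging
    (a, i) and (b, j).

    No infinite sum has to be rearranged: the partial sums of the left side up
    to l < N b and those of the right side up to l < N a equal the same finite
    triple sum (alternating_sum_swap), so the limits agree as soon as all the
    series converge (alternating_series_swap). Convergence is elementary:
    [y + l]_q^n is a polynomial of degree n in q^l, so each series is
    a finite combination of geometric series with ratios - q^(h + k), k <= n
    (is_cvg_genocchi_series, used for the bases q^a and q^b).

    For m = 0 both sides vanish. The degenerate base q = 0 obeys the same
    scaling rule, and its series reduce to their first term. *)

(** * Series that are combinations of geometric series *)

Lemma is_cvg_series_expr (K : numFieldType) (z : K) :
  z != 1 -> (z ^+ n @[n --> \oo] --> (0 : K))%classic ->
  cvgn (series (fun l => z ^+ l)).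
Proof.
move=> z1 z0.
rewrite (_ : (fun l => z ^+ l) = geometric 1 z); last first.
  by apply/funext => l; rewrite /= mul1r.
rewrite geometric_seriesE //.
apply: is_cvgM; last exact: is_cvg_cst.
apply: is_cvgM; first exact: is_cvg_cst.
apply: is_cvgB; first exact: is_cvg_cst.
by apply/cvg_ex; exists 0.
Qed.

(** Splitting off one factor 1 - c s^l writes the series as a difference of two
    series with exponent n, of ratios r and r s; hence the hypothesis on all
    the ratios r s^k. *)
Lemma is_cvg_series_expr_binomial (K : numFieldType) (r s c : K) (n : nat) :
  (forall k, cvgn (series (fun l => (r * s ^+ k) ^+ l))) ->
  cvgn (series (fun l => r ^+ l * (1 - c * s ^+ l) ^+ n)).
Proof.
elim: n r => [|n IHn] r cvg_rs.
  have -> : (fun l => r ^+ l * (1 - c * s ^+ l) ^+ 0) =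
      (fun l => (r * s ^+ 0) ^+ l).
    by apply/funext => l; rewrite !expr0 !mulr1.
  exact: cvg_rs.
have -> : (fun l => r ^+ l * (1 - c * s ^+ l) ^+ n.+1) =
    (fun l => r ^+ l * (1 - c * s ^+ l) ^+ n)
    - c *: (fun l => (r * s) ^+ l * (1 - c * s ^+ l) ^+ n).
  apply/funext => l; rewrite !fctE /GRing.scale /= exprMn exprS; ring.
apply: is_cvg_seriesB; first by apply: IHn.
apply: is_cvg_seriesZ; apply: IHn => k.
by have := cvg_rs k.+1; rewrite exprS mulrA.
Qed.

(** * Exchanging the roles of a and b *)

Lemma cvg_series_muln (K : numFieldType) (u : nat -> K) (b : nat) :
  (0 < b)%N -> cvgn (series u) ->
  (series u (N * b)%N @[N --> \oo] --> limn (series u))%classic.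
Proof.
move=> b0 cu.
exact: (cvg_comp _ _ (@cvg_mulnr b b0) cu).
Qed.

Lemma sum_nat_muln (V : nmodType) (u : nat -> V) (b N : nat) :
  \sum_(0 <= l < N * b) u l = \sum_(k < N) \sum_(j < b) u (b * k + j)%N.
Proof.
elim: N => [|N IHN]; first by rewrite mul0n big_nil big_ord0.
rewrite big_ord_recr /= -IHN mulSn addnC (big_cat_nat _ (n := (N * b)%N)) ?leq_addr //=.
congr (_ + _); rewrite -{1}[(N * b)%N]add0n big_addn addKn big_mkord.
by apply: eq_bigr => j _; rewrite addnC mulnC.
Qed.

(** Both sides equal the sum of (-1)^(i + j + k) T (b i + a j + a b k) over
    i < a, j < b and k < N: on the left l = b k + j, on the right l = a k + i.
    Oddness of a and b is what makes the sign of l equal to that of k + j,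
    respectively k + i. *)
Lemma alternating_sum_swap (K : pzRingType) (T : nat -> K) (a b N : nat) :
  odd a -> odd b ->
  \sum_(i < a) (-1) ^+ i *
    (\sum_(0 <= l < N * b) (-1) ^+ l * T (b * i + a * l)%N) =
  \sum_(i < b) (-1) ^+ i *
    (\sum_(0 <= l < N * a) (-1) ^+ l * T (a * i + b * l)%N).
Proof.
have expand c d : odd d -> \sum_(i < c) (-1) ^+ i *
    (\sum_(0 <= l < N * d) (-1) ^+ l * T (d * i + c * l)%N) =
  \sum_(i < c) \sum_(j < d) \sum_(k < N)
    (-1) ^+ (i + j + k) * T (d * i + c * j + c * d * k)%N.
  move=> odd_d; apply: eq_bigr => i _.
  rewrite sum_nat_muln exchange_big mulr_sumr; apply: eq_bigr => j _.
  rewrite mulr_sumr; apply: eq_bigr => k _; rewrite mulrA -exprD; congr (_ * T _).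
    by rewrite -signr_odd !oddD oddM odd_d /= -!oddD signr_odd addnCA addnC.
  by rewrite mulnDr mulnA addnA addnAC.
move=> odd_a odd_b; rewrite !expand // exchange_big.
apply: eq_bigr => i _; apply: eq_bigr => j _; apply: eq_bigr => k _.
by rewrite (addnC j) (addnC (b * j)%N) (mulnC a b).
Qed.

(** Passing to the limit along different subsequences of partial sums on the two
    sides, N b and N a, makes the partial sums equal for every N. *)
Lemma alternating_series_swap (K : numFieldType) (T : nat -> K) (a b : nat) :
  odd a -> odd b ->
  (forall i, cvgn (series (fun l => (-1) ^+ l * T (b * i + a * l)%N))) ->
  (forall i, cvgn (series (fun l => (-1) ^+ l * T (a * i + b * l)%N))) ->
  \sum_(i < a) (-1) ^+ i *
    limn (series (fun l => (-1) ^+ l * T (b * i + a * l)%N)) =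
  \sum_(i < b) (-1) ^+ i *
    limn (series (fun l => (-1) ^+ l * T (a * i + b * l)%N)).
Proof.
have cvg_partial c d : odd d ->
    (forall i, cvgn (series (fun l => (-1) ^+ l * T (d * i + c * l)%N))) ->
    ((\sum_(i < c) (-1) ^+ i *
      (\sum_(0 <= l < N * d) (-1) ^+ l * T (d * i + c * l)%N)) @[N --> \oo] -->
    \sum_(i < c) (-1) ^+ i *
      limn (series (fun l => (-1) ^+ l * T (d * i + c * l)%N)))%classic.
  move=> odd_d cvgT.
  apply: cvg_big => [|i _]; first exact: add_continuous.
  apply: cvgM; first exact: cvg_cst.
  by apply: cvg_series_muln; first exact: odd_gt0.
move=> odd_a odd_b cvga cvgb.
have lim_a := cvg_partial a b odd_b cvga.
have lim_b := cvg_partial b a odd_a cvgb.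
apply: (cvg_unique _ lim_a) => //.
rewrite (_ : (fun N => _) = (fun N => \sum_(i < b) (-1) ^+ i *
    (\sum_(0 <= l < N * a) (-1) ^+ l * T (a * i + b * l)%N))) //.
by apply/funext => N; apply: alternating_sum_swap.
Qed.

(** * The complex q-bracket *)

(** Reduces to the real case through the norm: a positive complex number is
    real, so the neighbourhoods of 0 are governed by real radii. *)
Lemma cvg_exprc (R : realType) (z : R[i]) :
  `|z| < 1 -> (z ^+ n @[n --> \oo] --> (0 : R[i]))%classic.
Proof.
move=> z1; apply: norm_cvg0; apply/cvgr0Pnorm_lt => e e0.
have [r rE] : exists r : R, `|z| = r%:C by rewrite normc_def; eexists.
have [s sE] : exists s : R, e = s%:C.
  by apply/complex_realP; rewrite realE ltW.
have r0 : 0 <= r by rewrite -lecR -rE normr_ge0.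
have r1 : `|r| < 1 by rewrite ger0_norm // -ltcR -rE.
have s0 : 0 < s by rewrite -ltcR -sE.
have /cvgr0Pnorm_lt/(_ s s0) := cvg_expr r1.
apply: filterS => n /=.
by rewrite !normrX !normr_id rE sE -rmorphXn ger0_norm //= ltcR.
Qed.

Lemma cexpD (R : realType) (y z : R[i]) : cexp (y + z) = cexp y * cexp z.
Proof.
case: y z => [y1 y2] [z1 z2]; rewrite /cexp /= expRD cosD sinD.
apply/eqP; rewrite eq_complex /=; apply/andP; split; apply/eqP; ring.
Qed.

Lemma cexp_nat (R : realType) (n : nat) (z : R[i]) : cexp (n%:R * z) = cexp z ^+ n.
Proof.
elim: n => [|n IHn].
  by rewrite mul0r expr0 /cexp /= expR0 cos0 sin0 mul1r.
by rewrite -natr1 mulrDl mul1r cexpD IHn exprSr.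
Qed.

Lemma qpow_nat (R : realType) (q L : R[i]) (n : nat) :
  (q != 0 -> cexp L = q) -> qpow q L n%:R = q ^+ n.
Proof.
move=> hL; rewrite /qpow; case: eqVneq => [->|q0]; first by rewrite expr0n pnatr_eq0.
by rewrite cexp_nat hL.
Qed.

Lemma qpow_scale (R : realType) (q L : R[i]) (a : nat) (y : R[i]) :
  (0 < a)%N ->
  qpow (q ^+ a) (a%:R * L) y = qpow q L (a%:R * y).
Proof.
move=> a0; rewrite /qpow expf_eq0 a0 mulf_eq0 pnatr_eq0 eqn0Ngt a0 /=.
by rewrite mulrCA mulrA.
Qed.

(** The rule also covers q = 0, where [a]_0 = 1 and the vanishing of y and of
    a y are equivalent. *)
Lemma qbracket_scale (R : realType) (q L : R[i]) (a : nat) (y : R[i]) :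
  (q != 0 -> cexp L = q) -> `|q| < 1 -> (0 < a)%N ->
  qbracket q L a%:R * qbracket (q ^+ a) (a%:R * L) y = qbracket q L (a%:R * y).
Proof.
move=> hL q1 a0; rewrite /qbracket (qpow_nat R q L a hL) qpow_scale //.
have qa1 : 1 - q ^+ a != 0.
  rewrite subr_eq0; apply: contraTneq q1 => q1.
  have : `|q| ^+ a == 1 by rewrite -normrX -q1 normr1.
  by rewrite pexpr_eq1 ?normr_ge0 // => /eqP ->; rewrite ltxx.
by rewrite mulrC mulrA divfK.
Qed.

(** For q != 0, the bracket [y + l]_q is (1 - q^y q^l) / (1 - q), so the terms
    have the shape r^l (1 - c s^l)^n with r = - q^h and s = q. *)
Lemma is_cvg_genocchi_series (R : realType) (q L : R[i]) (h n : nat) (y : R[i]) :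
  (q != 0 -> cexp L = q) -> `|q| < 1 -> (0 < h)%N ->
  cvgn (series (fun l : nat =>
    (-1) ^+ l * q ^+ (h * l) * qbracket q L (y + l%:R) ^+ n)).
Proof.
move=> hL q1 h0.
have cvg_geo k : cvgn (series (fun l => (- q ^+ h * q ^+ k) ^+ l)).
  have z1 : `|- q ^+ h * q ^+ k| < 1.
    rewrite mulNr normrN -exprD normrX exprn_ilt1 ?normr_ge0 //.
    by rewrite addn_eq0 negb_and -lt0n h0.
  apply: is_cvg_series_expr; last exact: cvg_exprc.
  by apply: contraTneq z1 => ->; rewrite normr1 ltxx.
(* For q = 0, where q^(y + l) does not factor as q^y q^l, only the term l = 0
   survives and the series is a multiple of the one with ratio 0. *)
have [q0|q0] := eqVneq q 0.
  rewrite (_ : (fun l => _) =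
      (qbracket q L y ^+ n) *: (fun l => (- q ^+ h * q ^+ 0) ^+ l)).
    exact: is_cvg_seriesZ.
  apply/funext => l; rewrite fctE /GRing.scale /= expr0 mulr1 [RHS]mulrC.
  rewrite [in RHS]exprNn -exprM.
  case: l => [|l]; first by rewrite addr0.
  by rewrite q0 expr0n muln_eq0 eqn0Ngt h0 /= mulr0 !mul0r.
rewrite (_ : (fun l => _) = ((1 - q) ^- n) *:
    (fun l => (- q ^+ h) ^+ l * (1 - qpow q L y * q ^+ l) ^+ n)).
  by apply: is_cvg_seriesZ; apply: is_cvg_series_expr_binomial.
apply/funext => l; rewrite fctE /GRing.scale /= [RHS]mulrC.
rewrite [in RHS]exprNn -exprM /qbracket expr_div_n -!mulrA.
congr (_ * (_ * ((1 - _) ^+ _ * _))).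
by rewrite -(qpow_nat R q L l hL) /qpow (negbTE q0) mulrDl cexpD.
Qed.

(** * Symmetry of the Genocchi sums *)

(** The factor q^(i b h) completes q^(a h l) to q^(h p), and a times the argument
    b x + b i / a + l equals a b x + p, with the same p = b i + a l. So the
    summand depends on i and l only through p, as alternating_series_swap
    requires. *)
Lemma qbracket_genocchi_scale (R : realType) (q L : R[i]) (h n a b : nat)
    (x : R[i]) (i : nat) :
  `|q| < 1 -> (q != 0 -> cexp L = q) -> (0 < h)%N -> (0 < a)%N ->
  let u := fun l : nat => (-1) ^+ l * (q ^+ (h * (b * i + a * l)) *
    qbracket q L ((a * b)%:R * x + (b * i + a * l)%:R) ^+ n) in
  cvgn (series u) /\
  qbracket q L a%:R ^+ n * (q ^+ (i * b * h) *
    genocchi (q ^+ a) (a%:R * L) h n.+1 (b%:R * x + b%:R * i%:R / a%:R)) =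
  n.+1%:R * qbracket (q ^+ a) (a%:R * L) 2%:R * limn (series u).
Proof.
move=> q1 hL h0 a0 u.
set y := b%:R * x + b%:R * i%:R / a%:R.
set v := fun l : nat => (-1) ^+ l * (q ^+ a) ^+ (h * l) *
  qbracket (q ^+ a) (a%:R * L) (y + l%:R) ^+ n.
have cvg_v : cvgn (series v).
  apply: is_cvg_genocchi_series => //.
    move=> qa; rewrite cexp_nat hL //.
    by apply: contraNneq qa => ->; rewrite expr0n eqn0Ngt a0.
  by rewrite normrX exprn_ilt1 ?normr_ge0 // -lt0n.
set k := qbracket q L a%:R ^+ n * q ^+ (i * b * h).
have -> : u = k *: v.
  apply/funext => l; rewrite /u /v /k fctE /GRing.scale /=.
  have -> : (a * b)%:R * x + (b * i + a * l)%:R = a%:R * (y + l%:R).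
    rewrite /y natrD !natrM; field.
    by rewrite pnatr_eq0 -lt0n.
  rewrite -qbracket_scale // exprMn -exprM mulnDr exprD.
  rewrite (_ : (h * (b * i) = i * b * h)%N); last by rewrite mulnC (mulnC b).
  rewrite (_ : (h * (a * l) = a * (h * l))%N); last by rewrite mulnCA.
  ring.
split; first exact: is_cvg_seriesZ.
rewrite lim_seriesZ // /GRing.scale /= /k -/v; ring.
Qed.

Theorem theorem12 (R : realType) (q L : R[i]) (h m a b : nat) (x : R[i])
    (hq : `|q| < 1) (hL : q != 0 -> cexp L = q)
    (hh : (0 < h)%N) (ha : odd a) (hb : odd b) :
  qbracket (q ^+ b) (b%:R * L) 2%:R * qbracket q L a%:R ^ (m%:Z - 1) *
    (\sum_(0 <= i < a) (-1) ^+ i * q ^+ (i * b * h) *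
       genocchi (q ^+ a) (a%:R * L) h m (b%:R * x + b%:R * i%:R / a%:R)) =
  qbracket (q ^+ a) (a%:R * L) 2%:R * qbracket q L b%:R ^ (m%:Z - 1) *
    (\sum_(0 <= i < b) (-1) ^+ i * q ^+ (i * a * h) *
       genocchi (q ^+ b) (b%:R * L) h m (a%:R * x + a%:R * i%:R / b%:R)).
Proof.
case: m => [|n]; first by rewrite /= !big1 ?mulr0 // => i _; rewrite mulr0.
have -> : n.+1%:Z - 1 = n by rewrite -addn1 PoszD addrK.
rewrite -!exprnP !big_mkord.
have side c d : odd c ->
    qbracket (q ^+ d) (d%:R * L) 2%:R * qbracket q L c%:R ^+ n *
    (\sum_(i < c) (-1) ^+ i * q ^+ (i * d * h) *
      genocchi (q ^+ c) (c%:R * L) h n.+1 (d%:R * x + d%:R * i%:R / c%:R)) =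
    n.+1%:R * (qbracket (q ^+ c) (c%:R * L) 2%:R *
      qbracket (q ^+ d) (d%:R * L) 2%:R) *
    \sum_(i < c) (-1) ^+ i * limn (series (fun l : nat => (-1) ^+ l *
      (q ^+ (h * (d * i + c * l)) *
       qbracket q L ((c * d)%:R * x + (d * i + c * l)%:R) ^+ n))).
  move=> odd_c; rewrite !mulr_sumr; apply: eq_bigr => i _.
  have [_ E] := qbracket_genocchi_scale R q L h n c d x i hq hL hh (odd_gt0 odd_c).
  rewrite [LHS](_ : _ = qbracket (q ^+ d) (d%:R * L) 2%:R * (-1) ^+ i *
    (qbracket q L c%:R ^+ n * (q ^+ (i * d * h) *
    genocchi (q ^+ c) (c%:R * L) h n.+1 (d%:R * x + d%:R * i%:R / c%:R)))).
    rewrite E; ring.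
  ring.
rewrite !side //.
rewrite [X in _ * X * _ = _]mulrC (mulnC b a); congr (_ * _).
apply: (alternating_series_swap _ (fun p => q ^+ (h * p) *
  qbracket q L ((a * b)%:R * x + p%:R) ^+ n) a b ha hb) => i.
  by have [] := qbracket_genocchi_scale R q L h n a b x i hq hL hh (odd_gt0 ha).
by have [] := qbracket_genocchi_scale R q L h n b a x i hq hL hh (odd_gt0 hb);
  rewrite (mulnC b a).
Qed.
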